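(* For every $n\ge 0$, $$\sum_{T\in\mathcal T_{n+1}}t^{\,\mathrm{pv}(T)}=t\,\prod_{i=0}^{n-1}\big((i+1)\,t+(n-i)\big)$$ and $$\sum_{P\in\mathcal P_{n+1}}t^{\,\mathrm{pv}(P)}=t\,\prod_{i=0}^{n-1}\big((2i+1)\,t+(n-i)\big).$$
   Context: $[n]=\{1,\dots,n\}$. $\mathcal T_{n}$ is the set of rooted labeled trees with vertex set $[n]$ (acyclic connected graphs on $[n]$ with a distinguished root, which may be any vertex). $\mathcal P_{n}$ is the set of plane trees with vertex set $[n]$, i.e. rooted labeled trees on $[n]$ in which the children of each vertex are linearly ordered. A vertex $j$ is a descendant of $i$ if $i$ lies on the path from $j$ to the root (so $i$ is a descendant of itself). A vertex $i$ is proper if $i$ is the smallest among all its descendants, and $\mathrm{pv}(T)$ is the number of proper vertices of $T$. An empty product equals $1$. *)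

(* Defs.v *)
From mathcomp Require Import all_boot all_order all_algebra.

Set Implicit Arguments.
Unset Strict Implicit.
Unset Printing Implicit Defensive.

(* The label k + 1 of [m] = {1, ..., m} is represented by k : 'I_m. *)

Section Graphs.

Variable m : nat.
Implicit Types (E : {set {set 'I_m}}) (T : {set {set 'I_m}} * 'I_m).

Definition simple_graph E : bool := [forall e in E, #|e| == 2].

Definition adj E : rel 'I_m := fun x y => [set x; y] \in E.

Definition connected_graph E : bool := [forall x, forall y, connect (adj E) x y].

(* A cycle without repeated vertices has length at most m, so it is enough to
   range over the finite type m.-bseq 'I_m; see acyclic_graphP. *)
Definition acyclic_graph E : bool :=
  [forall c : m.-bseq 'I_m, (2 < size c) ==> ~~ ucycleb (adj E) c].

(* T = (edge set, root) *)
Definition is_rooted_tree T : bool :=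
  [&& simple_graph T.1, connected_graph T.1 & acyclic_graph T.1].

Definition rooted_trees : {set {set {set 'I_m}} * 'I_m} :=
  [set T | is_rooted_tree T].

(* j is a descendant of i: some simple path from j to the root (in a tree, the
   unique one) goes through i; see descendantP. *)
Definition descendant T (i j : 'I_m) : bool :=
  [exists p : m.-bseq 'I_m,
    [&& path (adj T.1) j p, last j p == T.2, uniq (j :: p) & i \in j :: p]].

Definition proper_vertex T (i : 'I_m) : bool :=
  [forall j, descendant T i j ==> (i <= j)].

Definition pv T : nat := #|[set i | proper_vertex T i]|.

Definition children T (i : 'I_m) : {set 'I_m} :=
  [set j | adj T.1 i j & descendant T i j].

(* (x, y) \in R means that x is below or equal to y. *)
Definition linear_order_on (A : {set 'I_m}) (R : {set 'I_m * 'I_m}) : bool :=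
  [&& R \subset setX A A,
      [forall x in A, (x, x) \in R],
      [forall x, forall y, ((x, y) \in R) && ((y, x) \in R) ==> (x == y)],
      [forall x, forall y, forall z,
        ((x, y) \in R) && ((y, z) \in R) ==> ((x, z) \in R)]
    & [forall x in A, forall y in A, ((x, y) \in R) || ((y, x) \in R)]].

(* P = (rooted tree, linear order on the children of each vertex) *)
Definition plane_trees :
    {set ({set {set 'I_m}} * 'I_m) * {ffun 'I_m -> {set 'I_m * 'I_m}}} :=
  [set P : ({set {set 'I_m}} * 'I_m) * {ffun 'I_m -> {set 'I_m * 'I_m}} |
     is_rooted_tree P.1 & [forall i, linear_order_on (children P.1 i) (P.2 i)]].

Lemma size_uniq_ord (s : seq 'I_m) : uniq s -> size s <= m.
Proof. by move=> /card_uniqP <-; rewrite -[leqRHS]card_ord max_card. Qed.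

Lemma acyclic_graphP E :
  reflect (forall c : seq 'I_m, 2 < size c -> ~ ucycle (adj E) c)
          (acyclic_graph E).
Proof.
apply: (iffP forallP) => [acE c c2 /[dup] ucE /andP[_ /size_uniq_ord cm]|acE c].
  by have := acE (Bseq cm); rewrite /= c2 => /negP; apply.
by apply/implyP => /acE ncE; apply/negP.
Qed.

Lemma descendantP T (i j : 'I_m) :
  reflect (exists p : seq 'I_m,
    [/\ path (adj T.1) j p, last j p = T.2, uniq (j :: p) & i \in j :: p])
    (descendant T i j).
Proof.
apply: (iffP existsP) => [[p /and4P[pp /eqP pl pu pi]]|[p [pp pl pu pi]]].
  by exists p.
have pm : size p <= m by apply: leq_trans (leqnSn _) (size_uniq_ord pu).
by exists (Bseq pm); apply/and4P; split=> //; apply/eqP.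
Qed.

End Graphs.

(* Main.v *)
Require Import Defs.
From mathcomp Require Import all_boot all_order all_algebra ring.

Set Implicit Arguments.
Unset Strict Implicit.
Unset Printing Implicit Defensive.

Import GRing.Theory.
Local Open Scope ring_scope.

(** A rooted tree is encoded by its parent function, the root being its own
parent, and both identities are instances of one weighted count. Let a vertex
with [c] children contribute [wdeg q c], the product of [1 + q * j] for
[j < c]; this is [1] for [q = 0] and [c!], the number of ways to order the
children, for [q = 1].

The count explores a tree in the way of the Foata-Fuchs coding. Vertices are
visited one at a time, from the root downwards, always heading for the smallest
unvisited vertex [u]. The state of the exploration is the set [S] of visited
vertices, the tree on [S], and the tip [x]: the lowest visited ancestor of [u].
The next vertex visited is the child of [x] on the way to [u]. If it is [u]
itself, then [u] is proper, because every visited vertex is visited after its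
ancestors and so all descendants of [u] are unvisited; a new target is chosen,
and its tip may be any visited vertex [a]. A new child of [a] multiplies the
weight by [1 + q * c], where [c] is the number of visited children of [a];
summing over the [s + 1] visited vertices, which have [s] visited children in
total, gives [(s + 1) + q * s]. If it is another vertex [y], then [y] is not
proper because it lies above the smaller [u], it becomes the tip, and there are
[n - s] choices for it among the [n + 1] vertices. So the step that visits the
[(s + 1)]-st vertex contributes the factor [((s + 1) + q * s) * t + (n - s)]
whatever the state is ([tip_sumE], resting on the one-step recurrence
[tip_sum_rec]), and the last vertex, which is always proper, contributes [t].
This is [rooted_sum].

The passage from edge sets to parent functions ([sum_rooted_trees]) rests on the
fact that a simple path ending at the root never goes from a parent to a child
([no_descent]): such a path is then the sequence of iterated parents. For plane
trees, the sum over the orderings is replaced by a factor [c!] per vertex by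
[card_linear_orders]. *)

(** * Parent functions *)

Section ParentFunctions.

Variable m : nat.
Implicit Types (f g : {ffun 'I_m -> 'I_m}) (S : {set 'I_m}).

(** The root is the one vertex that is its own parent, see [rooted_at_fix]. *)
Definition rooted_at (r : 'I_m) f : bool :=
  (f r == r) && [forall j, fconnect f j r].

Definition fproper f (v : 'I_m) : bool :=
  [forall j, fconnect f j v ==> (v <= j)%N].

Definition fchildren f (v : 'I_m) : {set 'I_m} :=
  [set j | f j == v & j != v].

Lemma rooted_at_ind r f : rooted_at r f ->
  forall P : 'I_m -> Prop,
  P r -> (forall j, j != r -> P (f j) -> P j) -> forall j, P j.
Proof.
case/andP=> _ /forallP fr P Pr Pf j; have := iter_findex (fr j).
move: (findex f j r) => k; elim: k j => [|k IHk] j; first by move=> /= ->.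
rewrite iterSr => /IHk Pfj; have [-> //|jr] := eqVneq j r.
exact: Pf.
Qed.

Lemma rooted_at_anti r f x y :
  rooted_at r f -> fconnect f x y -> fconnect f y x -> x = y.
Proof.
move=> fT; elim/(rooted_at_ind fT): x y => [|x xr IHx] y.
  case/andP: fT => /eqP frr _ /iter_findex <- _.
  by elim: findex => //= k <-; rewrite frr.
move=> xy yx; have [//|nxy] := eqVneq x y.
have fxy : fconnect f (f x) y.
  have := xy; rewrite -(iter_findex xy); case: findex (iter_findex xy) => [/= e|k _].
    by rewrite e eqxx in nxy.
  by rewrite iterSr => _; apply: fconnect_iter.
have fxx : f x = x by apply: IHx (connect_trans fxy yx) (fconnect1 f x).
by have := IHx _ fxy (connect_trans yx (fconnect1 f x)); rewrite fxx.
Qed.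

Lemma rooted_at_fix r f j : rooted_at r f -> (f j == j) = (j == r).
Proof.
move=> fT; apply/eqP/eqP => [fj|->]; last by case/andP: fT => /eqP.
case/andP: fT => _ /forallP/(_ j)/iter_findex <-.
by elim: findex => //= k <-; rewrite fj.
Qed.

Definition fclosed_set f S := forall z, z \in S -> f z \in S.

Lemma fclosed_connect f S y z :
  fclosed_set f S -> fconnect f y z -> y \in S -> z \in S.
Proof.
move=> Sf /iter_findex <- yS.
by elim: findex => //= k; apply: Sf.
Qed.

(** * Exploring a tree towards its smallest unvisited vertex *)

Section Exploration.

Variable r : 'I_m.

Definition extends S g f : bool := [forall z in S, f z == g z].

Lemma extendsP S g f : reflect {in S, f =1 g} (extends S g f).
Proof. by apply: (iffP forall_inP) => fg z /fg /eqP. Qed.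

Definition upd g (y x : 'I_m) : {ffun 'I_m -> 'I_m} :=
  [ffun z => if z == y then x else g z].

Lemma extends_upd S g f y x :
  y \notin S -> extends (y |: S) (upd g y x) f = extends S g f && (f y == x).
Proof.
move=> yS; apply/extendsP/andP => [fg|[/extendsP fg /eqP fy] z].
  split; last by rewrite fg ?setU11 // ffunE eqxx.
  apply/extendsP => z zS; rewrite fg ?setU1r // ffunE.
  by case: eqP => // zy; rewrite -zy zS in yS.
rewrite !inE ffunE; case: eqP => [-> //|_ /= zS]; exact: fg.
Qed.

(** A state of the exploration. Only the values of [g] on [S] matter, but it is
convenient that [g] be a whole tree: this is then inherited by [upd g y x]. *)
Definition explored S g := [/\ r \in S, rooted_at r g & fclosed_set g S].

Lemma explored_closed S g f : explored S g -> extends S g f -> fclosed_set f S.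
Proof. by case=> _ _ gS /extendsP fg z zS; rewrite fg ?gS. Qed.

Lemma explored_upd S g y x :
  explored S g -> x \in S -> y \notin S -> explored (y |: S) (upd g y x).
Proof.
move=> [rS gT gS] xS yS.
have updS z : z \in S -> upd g y x z = g z.
  by move=> zS; rewrite ffunE; case: eqP => // zy; rewrite -zy zS in yS.
split; first by rewrite setU1r.
- apply/andP; split; first by rewrite updS //; case/andP: gT.
  have conS z : z \in S -> fconnect (upd g y x) z r.
    elim/(rooted_at_ind gT): z => [|z zr IHz] zS; first exact: connect0.
    apply: connect_trans (fconnect1 _ _) _; rewrite updS //.
    by apply: IHz; apply: gS.
  apply/forallP => j; elim/(rooted_at_ind gT): j => [|j jr IHj].
    exact: connect0.
  apply: connect_trans (fconnect1 _ _) _; rewrite ffunE.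
  by case: eqP => // _; apply: conS.
- move=> z; rewrite !inE => /orP[/eqP->|zS]; first by rewrite ffunE eqxx xS orbT.
  by rewrite updS // gS // orbT.
Qed.

(** The highest unvisited ancestor of [u]. Its parent is the tip. *)
Definition exitv S f (u : 'I_m) : 'I_m :=
  odflt u [pick y | [&& y \notin S, f y \in S & fconnect f u y]].

(** Two ancestors of [u] are comparable, and what lies above a visited vertex is
visited, so at most one unvisited ancestor of [u] has a visited parent; climbing
from [u] to the visited root, one meets such an ancestor. *)
Lemma exitvE S f u y :
  r \in S -> rooted_at r f -> fclosed_set f S -> u \notin S ->
  (exitv S f u == y) = [&& y \notin S, f y \in S & fconnect f u y].
Proof.
move=> rS fT fS uS; rewrite /exitv; case: pickP => [z /and3P[zS fzS uz]|none] /=.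
  apply/eqP/and3P => [<- //|[yS fyS uy]].
  (* If [b] were strictly above [a], it would be above the visited [f a]. *)
  have next a b : fconnect f a b -> f a \in S -> b \notin S -> a = b.
    move=> /iter_findex; case: findex => [//|k]; rewrite iterSr => ab faS.
    by rewrite -ab (fclosed_connect fS (fconnect_iter f k (f a)) faS).
  have [/next ->//|/next <- //] : fconnect f z y \/ fconnect f y z.
  rewrite -(iter_findex uz) -(iter_findex uy).
  have /orP[le|le] := leq_total (findex f u z) (findex f u y).
    by left; rewrite -(subnK le) iterD fconnect_iter.
  by right; rewrite -(subnK le) iterD fconnect_iter.
exfalso; suff [z] : exists z, [&& z \notin S, f z \in S & fconnect f u z].
  by rewrite none.
elim/(rooted_at_ind fT): u uS {none} => [|u ur IHu] uS; first by rewrite rS in uS.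
have [fuS|fuS] := boolP (f u \in S); first by exists u; rewrite uS fuS connect0.
have [z /and3P[zS fzS fuz]] := IHu fuS; exists z; rewrite zS fzS.
exact: connect_trans (fconnect1 f u) fuz.
Qed.

Lemma exitv_props S f u :
  r \in S -> rooted_at r f -> fclosed_set f S -> u \notin S ->
  [/\ exitv S f u \notin S, f (exitv S f u) \in S & fconnect f u (exitv S f u)].
Proof. by move=> rS fT fS uS; apply/and3P; rewrite -exitvE. Qed.

Section Weights.

Variables (R : comNzRingType) (t q : R).

(** The weight of a vertex with [c] children: each new child multiplies it by
[1 + q * c], that is by one way to attach the child plus [q] for each child
already there. *)
Definition wdeg (c : nat) : R := \prod_(j < c) (1 + q * j%:R).

Lemma wdegS c : wdeg c.+1 = wdeg c * (1 + q * c%:R).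
Proof. exact: big_ord_recr. Qed.

(** The visited vertices are left out of the exponent, as their contribution is
accounted for when they are visited. *)
Definition wt S f : R :=
  (\prod_v wdeg #|fchildren f v|) * t ^+ #|[set v | v \notin S & fproper f v]|.

Definition ext_sum S g : R := \sum_(f | rooted_at r f && extends S g f) wt S f.

Definition tip_sum S g u x : R :=
  \sum_(f | rooted_at r f && extends S g f && (f (exitv S f u) == x)) wt S f.

Lemma ext_sum_tip S g u : explored S g -> u \notin S ->
  ext_sum S g = \sum_(x in S) tip_sum S g u x.
Proof.
move=> gE uS; have [rS _ _] := gE; rewrite /ext_sum.
apply: partition_big => f /andP[fT fg].
by have [] := exitv_props rS fT (explored_closed gE fg) uS.
Qed.

Definition first_unvisited S (u : 'I_m) :=
  u \notin S /\ forall z, z \notin S -> (u <= z)%N.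

(** No descendant of an unvisited vertex is visited, so the smallest unvisited
vertex is proper. *)
Lemma wt_proper S f u : fclosed_set f S -> first_unvisited S u ->
  wt S f = t * wt (u |: S) f.
Proof.
move=> fS [uS umin]; rewrite /wt mulrCA -exprS; congr (_ * _ ^+ _).
rewrite (cardsD1 u) !inE uS /=.
have -> /= : fproper f u.
  apply/forallP => j; apply/implyP => ju; apply: umin.
  by apply: contra uS; apply: fclosed_connect fS ju.
by rewrite add1n; congr (_.+1); apply: eq_card => v; rewrite !inE negb_or andbA.
Qed.

Lemma wt_improper S f u y : first_unvisited S u -> y \notin S -> y != u ->
  fconnect f u y -> wt S f = wt (y |: S) f.
Proof.
move=> [_ umin] yS yu uy; rewrite /wt; congr (_ * _ ^+ _); apply: eq_card => v.
rewrite !inE negb_or; case: eqP => //= ->; rewrite yS /=.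
apply/negbTE/forallPn; exists u; rewrite negb_imply uy -ltnNge.
by rewrite ltn_neqAle umin // andbT eq_sym.
Qed.

(** One step of the exploration: split according to the child of the tip [x] on
the way to [u], which is either [u] or some [y], which becomes the tip. *)
Lemma tip_sum_rec S g u x : explored S g -> first_unvisited S u -> x \in S ->
  tip_sum S g u x = t * ext_sum (u |: S) (upd g u x)
     + \sum_(y | y \notin u |: S) tip_sum (y |: S) (upd g y x) u y.
Proof.
move=> gE uF xS; have [rS _ _] := gE; have [uS umin] := uF.
rewrite /tip_sum (partition_big (fun f => exitv S f u) [predC S]) /=; last first.
  move=> f /andP[/andP[fT fg] _].
  by have [] := exitv_props rS fT (explored_closed gE fg) uS.
rewrite (bigD1 u) //=; congr (_ + _).
  rewrite mulr_sumr; apply: eq_big => [f|f /andP[/andP[/andP[_ fg] _] _]].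
    have [fT|] //= := boolP (rooted_at r f); rewrite extends_upd //.
    have [fg|] //= := boolP (extends S g f).
    apply/andP/eqP => [[/eqP fx /eqP eu]|fx]; first by rewrite -fx eu.
    have /eqP-> : exitv S f u == u; last by rewrite fx.
    by rewrite (exitvE _ rS fT (explored_closed gE fg)) // uS fx xS connect0.
  exact: wt_proper (explored_closed gE fg) uF.
apply: eq_big => [y|y /andP[yS yu]]; first by rewrite !inE negb_or andbC.
have yE := explored_upd gE xS yS; have [rS' _ _] := yE.
have uS' : u \notin y |: S by rewrite !inE negb_or eq_sym yu.
apply: eq_big => [f|f /andP[/andP[/andP[fT fg] _] /eqP ey]]; last first.
  apply: (wt_improper uF) => //; rewrite -ey.
  by have [] := exitv_props rS fT (explored_closed gE fg) uS.
have [fT|] //= := boolP (rooted_at r f).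
have := @explored_closed _ _ f yE; rewrite extends_upd //.
have [fg|] //= := boolP (extends S g f); have fS := explored_closed gE fg.
move=> fS'; apply/andP/andP => [[/eqP fx /eqP ey]|[fy /eqP]].
  rewrite ey in fx; split; first exact/eqP.
  rewrite fx eqxx in fS'; have {}fS' := fS' isT.
  have [zS'] := exitv_props rS' fT fS' uS'.
  set z := exitv _ _ _ in zS' *; rewrite in_setU1 => /orP[//|fzS] uz.
  have zS : z \notin S by apply: contra zS'; apply: setU1r.
  have := exitvE z rS fT fS uS; rewrite zS fzS uz ey => /eqP yz.
  by rewrite yz setU11 in zS'.
have {}fS' := fS' fy.
have [_ _ uz fzy] := exitv_props rS' fT fS' uS'.
have /eqP-> : exitv S f u == y; last by rewrite fy eqxx.
rewrite exitvE // yS (eqP fy) xS -fzy.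
exact: connect_trans uz (fconnect1 _ _).
Qed.

Definition visited_children S g v : {set 'I_m} :=
  [set j in S | g j == v & j != v].

Lemma visited_children_upd S g y x v : x \in S -> y \notin S ->
  #|visited_children (y |: S) (upd g y x) v|
    = (#|visited_children S g v| + (v == x))%N.
Proof.
move=> xS yS; rewrite (cardsD1 y); rewrite /visited_children !inE ffunE eqxx /= addnC.
have yx : y != x by apply: contraNneq yS => ->.
congr (_ + nat_of_bool _)%N; last by rewrite eq_sym; case: eqP => // ->.
apply: eq_card => j; rewrite !inE ffunE.
by case: eqP => //= -> /=; rewrite (negbTE yS).
Qed.

Lemma visited_children_out S g y : fclosed_set g S -> y \notin S ->
  #|visited_children S g y| = 0%N.
Proof.
move=> gS yS; apply: eq_card0 => j; rewrite !inE; apply/and3P => -[jS /eqP gj _].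
by rewrite -gj gS in yS.
Qed.

(** Each visited vertex except the root is the child of one visited vertex. *)
Lemma sum_visited_children S g : explored S g ->
  (\sum_(v in S) #|visited_children S g v|)%N = #|S|.-1.
Proof.
case=> rS gT gS; rewrite (cardsD1 r S) rS /= add0n -sum1_card.
rewrite [RHS](partition_big g [in S]) /=; last first.
  by move=> j; rewrite !inE => /andP[_ /gS].
apply: eq_bigr => v vS; rewrite -sum1_card; apply: eq_bigl => j.
rewrite !inE -(rooted_at_fix j gT).
by case: (g j =P v) => [<-|_]; rewrite ?andbF //= andbT andbC eq_sym.
Qed.

Lemma prod_wdegS (c : 'I_m -> nat) a :
  \prod_v wdeg (c v + (v == a)) = (\prod_v wdeg (c v)) * (1 + q * (c a)%:R).
Proof.
rewrite (bigD1 a) //= [in RHS](bigD1 a) //= eqxx addn1 wdegS mulrAC.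
by congr (_ * _ * _); apply: eq_bigr => v /negbTE->; rewrite addn0.
Qed.

Definition step_factor i : R := ((i + 1)%:R + q * i%:R) * t + (m.-1 - i)%:R.

(** The factor of [tip_sum] at a state with [s] visited vertices. *)
Definition completion s : R := t * \prod_(s <= i < m.-1) step_factor i.

(** The factor of [ext_sum] at a state with [s] visited vertices; the first case is
that of a complete tree. *)
Definition ext_factor s : R :=
  if s == m then 1 else (s%:R + q * s.-1%:R) * completion s.

Lemma completion_rec s : (s < m)%N ->
  completion s = t * ext_factor s.+1 + completion s.+1 *+ (m.-1 - s).
Proof.
rewrite /ext_factor; have [sm _|sm lt_sm] := eqVneq s.+1 m.
  by rewrite /completion -sm /= subnn mulr0n addr0 big_geq.
have lt_sm1 : (s < m.-1)%N.
  by rewrite -ltnS (ltn_predK lt_sm) ltn_neqAle sm.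
rewrite /completion big_ltn // /step_factor addn1 -[_ *+ (_ - _)]mulr_natr /=.
ring.
Qed.

Lemma first_unvisited_ex S z : z \notin S -> exists u, first_unvisited S u.
Proof.
move=> zS; have [u uS umin] := @arg_minnP _ z [predC S] val zS.
by exists u.
Qed.

Lemma ext_sum_full S g : S = [set: 'I_m] -> rooted_at r g ->
  ext_sum S g = \prod_v wdeg #|visited_children S g v|.
Proof.
move=> -> gT; rewrite /ext_sum (big_pred1 g) => [|f]; last first.
  apply/andP/eqP => [[_ /extendsP fg]|->].
    by apply/ffunP => z; rewrite fg ?inE.
  by split=> //; apply/extendsP.
rewrite /wt [X in _ * X](_ : _ = 1); last first.
  by rewrite eq_card0 // => v; rewrite !inE.
rewrite mulr1; apply: eq_bigr => v _; congr (wdeg _).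
by apply: eq_card => j; rewrite !inE.
Qed.

Definition tip_formula S g u x : Prop :=
  tip_sum S g u x =
    (\prod_v wdeg (#|visited_children S g v| + (v == x))) * completion #|S|.

(** Choosing a new target: its tip runs over all visited vertices. The formula for
these tips is a hypothesis because the lemma is used inside the induction that
proves it. *)
Lemma ext_sumE S g : explored S g ->
  (forall u x, first_unvisited S u -> x \in S -> tip_formula S g u x) ->
  ext_sum S g = (\prod_v wdeg #|visited_children S g v|) * ext_factor #|S|.
Proof.
move=> gE tipE; rewrite /ext_factor -[X in _ == X]card_ord -cardsT.
have [full|/subsetPn[v _ vS]] := boolP ([set: 'I_m] \subset S).
  have -> : S = [set: 'I_m] by apply/eqP; rewrite eqEsubset subsetT.
  by rewrite eqxx mulr1 ext_sum_full //; case: gE.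
rewrite ifN; last first.
  by rewrite neq_ltn proper_card // properT; apply: contraNneq vS => ->.
have [u uF] := first_unvisited_ex vS; have [uS _] := uF.
rewrite (ext_sum_tip gE uS).
rewrite (eq_bigr _ (fun x xS => tipE u x uF xS)).
under [LHS]eq_bigr do rewrite prod_wdegS.
rewrite -mulr_suml -mulr_sumr big_split /= sumr_const.
by rewrite -mulr_sumr -natr_sum (sum_visited_children gE) mulrA.
Qed.

(** By induction on the number of unvisited vertices: the right-hand side depends
on the state only through the numbers of children, where the pending child of
the tip is counted, and through the size of [S]. *)
Lemma tip_sumE S g u x : explored S g -> first_unvisited S u -> x \in S ->
  tip_formula S g u x.
Proof.
move: {2}(m - #|S|)%N (leqnn (m - #|S|)) => k.
elim: k => [|k IHk] in S g u x * => Sk gE uF xS; have [uS _] := uF;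
  have Sm : (#|S| < m)%N
    by rewrite -[ltnRHS]card_ord; apply/proper_card/properP;
       split; [exact/subsetP|exists u].
  by move: Sk; rewrite leqNgt subn_gt0 Sm.
have cardSm y : y \notin S -> #|y |: S| = #|S|.+1 by move=> yS; rewrite cardsU1 yS.
have Sk' y : y \notin S -> (m - #|y |: S| <= k)%N.
  by move=> yS; rewrite cardSm // subnS -ltnS prednK ?subn_gt0.
rewrite /tip_formula tip_sum_rec // completion_rec // mulrDr mulrCA.
set c := fun v => (#|visited_children S g v| + (v == x))%N.
have cE y v : y \notin S -> #|visited_children (y |: S) (upd g y x) v| = c v.
  exact: visited_children_upd.
congr (t * _ + _).
  rewrite ext_sumE; [|exact: explored_upd|].
    by rewrite cardSm //; congr (_ * _); apply: eq_bigr => v _; rewrite cE.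
  by move=> *; apply: IHk; rewrite ?Sk' //; apply: explored_upd.
have tipE y : y \notin u |: S ->
    tip_sum (y |: S) (upd g y x) u y = (\prod_v wdeg (c v)) * completion #|S|.+1.
  rewrite in_setU1 negb_or => /andP[yu yS].
  have [_ _ gS] := gE.
  rewrite IHk ?cardSm ?setU11 //; first last.
  - split; first by rewrite in_setU1 negb_or eq_sym yu.
    by move=> z; rewrite in_setU1 negb_or => /andP[_]; apply: uF.2.
  - exact: explored_upd.
  - by rewrite -(cardSm y yS) Sk'.
  congr (_ * _); under eq_bigr do rewrite cE //.
  rewrite prod_wdegS /c visited_children_out // addnC.
  (* The pending child of the new tip [y] is its first, of factor [1]. *)
  by case: eqP yS => [->|_ _]; [rewrite xS | rewrite mulr0 addr0 mulr1].
rewrite (eq_bigr _ tipE) [LHS](eq_bigl [in ~: (u |: S)]) => [|y]; last by rewrite [RHS]inE.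
rewrite sumr_const (cardsCs (~: _)) setCK card_ord cardSm //.
by rewrite subnS -!subn1 subnAC mulrnAr.
Qed.

End Weights.
End Exploration.

Section Total.

Variables (R : comNzRingType) (t q : R).

Lemma explored_root r : explored r [set r] [ffun=> r].
Proof.
split; first exact: set11.
  rewrite /rooted_at ffunE eqxx; apply/forallP => j.
  by apply: connect_trans (fconnect1 _ _) _; rewrite ffunE.
by move=> z _; rewrite ffunE set11.
Qed.

Lemma extends_root r f : rooted_at r f -> extends [set r] [ffun=> r] f.
Proof.
by case/andP=> /eqP fr _; apply/extendsP => z /set1P->; rewrite fr ffunE.
Qed.

Lemma visited_children_root r v :
  #|visited_children [set r] [ffun=> r] v| = 0%N.
Proof.
apply: eq_card0 => j; rewrite !inE ffunE; case: (j =P r) => //= ->.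
by rewrite eq_sym; case: eqP.
Qed.

(** The choice of the root is one more step of the exploration, from the empty set
of visited vertices: the root is either the smallest vertex, which is then
proper, or one of the others, which is then the tip. *)
Lemma rooted_sum : (0 < m)%N ->
  \sum_r \sum_(f | rooted_at r f) wt t q set0 f = completion t q 0.
Proof.
move=> m_gt0.
have [|u uF] := @first_unvisited_ex set0 (Ordinal m_gt0); first by rewrite inE.
rewrite (bigD1 u) //= completion_rec // subn0; congr (_ + _).
  have -> : ext_factor t q 1 = ext_sum u t q [set u] [ffun=> u].
    rewrite ext_sumE; [|exact: explored_root|].
      rewrite cards1 big1 ?mul1r // => v _.
      by rewrite visited_children_root /wdeg big_ord0.
    by move=> *; apply: tip_sumE => //; apply: explored_root.
  rewrite /ext_sum mulr_sumr; apply: eq_big => f; last first.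
    by move=> fT; rewrite (@wt_proper _ _ _ set0 f u) ?setU0 // => z; rewrite inE.
  by apply/idP/andP => [fT|[]//]; split=> //; apply: extends_root.
rewrite (eq_bigr (fun=> completion t q 1)) => [|r ru].
  by rewrite sumr_const cardC1 card_ord.
have uF' : first_unvisited [set r] u.
  split; first by rewrite inE eq_sym.
  by move=> z _; apply: uF.2; rewrite inE.
have rE := explored_root r.
have := tip_sumE t q rE uF' (set11 r); rewrite /tip_formula cards1.
rewrite big1 ?mul1r => [<-|v _]; last first.
  rewrite visited_children_root /wdeg; case: eqP => _; last by rewrite big_ord0.
  by rewrite big_ord_recl big_ord0 mulr0 addr0 mulr1.
have rS : r \in [set r] by exact: set11.
apply: eq_big => [f|f fT].
  apply/idP/andP => [fT|[/andP[]//]]; rewrite fT extends_root //; split=> //.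
  have := exitv_props rS fT (explored_closed rE (extends_root fT)) uF'.1.
  by case=> _; rewrite inE.
rewrite (wt_improper _ _ uF _ ru) ?setU0 ?inE //.
by case/andP: fT => _ /forallP; apply.
Qed.

End Total.
End ParentFunctions.

(** * From edge sets to parent functions *)

Section TreesAsFunctions.

Variable m : nat.
Implicit Types (f g : {ffun 'I_m -> 'I_m}) (E : {set {set 'I_m}}).

Definition edges f : {set {set 'I_m}} := [set [set j; f j] | j in [set j | f j != j]].

Lemma set2_inj (T : finType) (a b c d : T) : [set a; b] = [set c; d] ->
  (a = c /\ b = d) \/ (a = d /\ b = c).
Proof.
move=> eqS; have /set2P[ac|ad] : a \in [set c; d] by rewrite -eqS set21.
  have /set2P[bc|bd] : b \in [set c; d] by rewrite -eqS set22.
    have : d \in [set a; b] by rewrite eqS set22.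
    by rewrite ac bc => /set2P[] ->; left.
  by left.
have /set2P[bc|bd] : b \in [set c; d] by rewrite -eqS set22.
  by right.
have : c \in [set a; b] by rewrite eqS set21.
by rewrite ad bd => /set2P[] ->; right.
Qed.

Lemma adj_edges f x y :
  adj (edges f) x y = (x != y) && ((f x == y) || (f y == x)).
Proof.
apply/imsetP/andP => [[j /[!inE] fj /set2_inj[][-> ->]]|[xy /orP[]/eqP fxy]].
- by rewrite eq_sym fj eqxx.
- by rewrite fj eqxx orbT.
- by exists x; rewrite ?inE fxy // eq_sym.
- by exists y; rewrite ?inE fxy // setUC.
Qed.

Lemma adj_sym E : symmetric (adj E).
Proof. by move=> x y; rewrite /adj setUC. Qed.

Section Rooted.

Variables (r : 'I_m) (f : {ffun 'I_m -> 'I_m}).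
Hypothesis fT : rooted_at r f.

(** After a step from a parent to a child, here from [f x] to [x], a simple path
can only go on downwards, since the parent is already used; the root, being its
own parent, can then only be reached if the path stops at once. *)
Lemma no_descent x p : path (adj (edges f)) x p -> uniq (x :: p) ->
  last x p = r -> f x \notin p -> p = [::].
Proof.
elim: p x => [//|a p IHp] x /= /andP[xa ap] /andP[xp up] lp fx.
move: xa; rewrite adj_edges => /andP[xa /orP[]/eqP e].
  by rewrite e inE eqxx in fx.
have p0 : p = [::].
  by apply: (IHp a ap up lp); rewrite e; apply: contra xp; rewrite inE orbC => ->.
rewrite p0 /= in lp; case/andP: fT => /eqP frr _.
by rewrite -e lp frr eqxx in xa.
Qed.

Lemma simple_path_fpath x p : path (adj (edges f)) x p -> uniq (x :: p) ->
  last x p = r -> fpath f x p.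
Proof.
elim: p x => [//|a p IHp] x /= /andP[xa ap] /andP[xp up] lp.
rewrite IHp // andbT; move: (xa); rewrite adj_edges => /andP[_ /orP[//|/eqP e]].
have p0 : p = [::].
  by apply: (no_descent ap up lp); rewrite e; apply: contra xp; rewrite inE orbC => ->.
rewrite p0 /= in lp; move: xp; rewrite -e lp inE.
by case/andP: fT => /eqP ->; rewrite eqxx.
Qed.

Lemma fpath_to_root j : exists p,
  [/\ fpath f j p, path (adj (edges f)) j p, last j p = r & uniq (j :: p)].
Proof.
have /connectP[p0 fp0 lp0] : fconnect f j r by case/andP: fT => _ /forallP.
case/shortenP: fp0 lp0 => p fp up _ lp; exists p; split=> //.
elim: p j fp up {lp} => [//|a p IHp] j /= /andP[/eqP ja ap] /andP[jp up].
rewrite IHp // andbT adj_edges ja eqxx andbT.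
by move: jp; rewrite inE => /norP[].
Qed.

Lemma descendant_edges i j : descendant (edges f, r) i j = fconnect f j i.
Proof.
apply/descendantP/idP => [[p [/= pp lp up ip]]|ji].
  have fp := simple_path_fpath pp up lp.
  exact: path_connect fp i ip.
have [p [fp pp lp up]] := fpath_to_root j; exists p; split=> //=.
have frr : f r = r by case/andP: fT => /eqP.
have closed_p y z : fpath f y z -> last y z = r ->
    forall a, a \in y :: z -> f a \in y :: z.
  elim: z y => [|b z IHz] y /=.
    by move=> _ -> a; rewrite !inE => /eqP->; rewrite frr.
  move=> /andP[/eqP yb bz] lz a; rewrite inE => /predU1P[->|az].
    by rewrite yb !inE eqxx orbT.
  by rewrite inE IHz ?orbT.
rewrite -(iter_findex ji); elim: (findex f j i) => [|k]; first exact: mem_head.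
exact: closed_p.
Qed.

Lemma children_edges i : children (edges f, r) i = fchildren f i.
Proof.
apply/setP => j; rewrite !inE descendant_edges /= adj_edges.
apply/andP/andP => [[/andP[ij /orP[/eqP fij|fji]] ji]|[/eqP fj ij]].
- have := rooted_at_anti fT (fconnect1 f i); rewrite fij => /(_ ji) eij.
  by rewrite eij eqxx in ij.
- by rewrite fji eq_sym.
- by rewrite eq_sym ij fj eqxx orbT -fj fconnect1.
Qed.

Lemma pv_edges : pv (edges f, r) = #|[set v | v \notin set0 & fproper f v]|.
Proof.
apply: eq_card => v; rewrite !inE; apply: eq_forallb => j.
by rewrite descendant_edges.
Qed.

Lemma edges_simple : simple_graph (edges f).
Proof.
apply/forall_inP => e /imsetP[j]; rewrite inE => fj ->.
by move: fj; rewrite cards2 eq_sym => ->.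
Qed.

Lemma edges_connected : connected_graph (edges f).
Proof.
have toroot x : connect (adj (edges f)) x r.
  by have [p [_ pp lp _]] := fpath_to_root x; apply/connectP; exists p.
apply/forallP => x; apply/forallP => y; apply: connect_trans (toroot x) _.
by rewrite (sym_connect_sym (@adj_sym _)).
Qed.

(** Both neighbours, on a cycle, of a deepest vertex of that cycle would be its
parent. *)
Lemma edges_acyclic : acyclic_graph (edges f).
Proof.
have toroot x : fconnect f x r by case/andP: fT => _ /forallP.
apply/acyclic_graphP => c c2 /andP[cyc uc].
have c0 : head r c \in c by case: (c) c2 => //= x s _; apply: mem_head.
have [x xc xmax] := @arg_maxnP _ (head r c) [in c] (fun x => findex f x r) c0.
(* A child of the deepest vertex [x] would be deeper. *)
have up y : y \in c -> adj (edges f) x y -> y = f x.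
  move=> yc; rewrite adj_edges => /andP[xy /orP[/eqP-> //|/eqP fy]].
  have ry : r != y.
    by rewrite eq_sym -(rooted_at_fix _ fT) fy.
  have := xmax y yc; rewrite (fconnect_findex (toroot y) ry) fy.
  by rewrite /geq /= ltnn.
have [i s cE] := rot_to xc.
have {}c2 : (2 < size (x :: s))%N by rewrite -cE size_rot.
have {}up y : y \in x :: s -> adj (edges f) x y -> y = f x.
  by rewrite -cE mem_rot; apply: up.
move: cyc uc; rewrite -(rot_cycle i) -(rot_uniq i) cE.
case: s {cE} c2 up => [//|y [//|z s]] _ up /= /andP[xy /andP[_]].
rewrite rcons_path => /andP[_ lx] /and3P[_ yzs _].
have ly : last z s = y.
  rewrite (up y) ?mem_head ?inE ?eqxx ?orbT //; apply: up; last by rewrite adj_sym.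
  by rewrite 2!inE mem_last !orbT.
by rewrite -ly mem_last in yzs.
Qed.

Lemma edges_tree : is_rooted_tree (edges f, r).
Proof. by rewrite /is_rooted_tree edges_simple edges_connected edges_acyclic. Qed.

End Rooted.

Lemma edges_inj r f g : rooted_at r f -> rooted_at r g -> edges f = edges g ->
  f = g.
Proof.
move=> fT gT efg; apply/ffunP => j.
have [p [fp pp lp up]] := fpath_to_root fT j.
have := simple_path_fpath gT; rewrite -efg => /(_ j p pp up lp).
case: p fp pp lp up => [_ _ /= -> _ _|a p /= /andP[/eqP-> _] _ _ _ /andP[/eqP-> _] //].
by move: fT gT => /andP[/eqP-> _] /andP[/eqP-> _].
Qed.

(** Each vertex other than [r] picks a neighbour closer to [r]. *)
Lemma spanning_parent E (r : 'I_m) : connected_graph E ->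
  exists2 f, rooted_at r f & forall x, x != r -> adj E x (f x).
Proof.
move=> /forallP Ec.
pose walk x k := [exists p : k.-tuple 'I_m, path (adj E) x p && (last x p == r)].
pose shortest x k := walk x k /\ forall k', walk x k' -> (k <= k')%N.
have /fin_all_exists[d dP] x : exists k, shortest x k.
  have /forallP/(_ r)/connectP[p xp lp] := Ec x.
  have ex : exists k, walk x k.
    by exists (size p); apply/existsP; exists (in_tuple p); rewrite xp lp /=.
  by case: (ex_minnP ex) => k; exists k.
pose parent x y := if x == r then y = r else adj E x y /\ (d y < d x)%N.
have /fin_all_exists[F FP] x : exists y, parent x y.
  rewrite /parent; have [xr|xr] := eqVneq x r; first by exists r.
  have [/existsP[[p /= /eqP sp] /andP[xp lp]] _] := dP x.
  case: p sp xp lp => [_ _ /= xr'|y p /= sp]; first by rewrite xr' in xr.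
  case/andP=> xy yp lp; exists y; split=> //; rewrite -sp ltnS.
  by apply: (dP y).2; apply/existsP; exists (in_tuple p); rewrite yp.
exists (finfun F) => [|x xr]; last by have := FP x; rewrite /parent ffunE (negbTE xr) => -[].
apply/andP; split; first by have := FP r; rewrite /parent ffunE eqxx => ->.
apply/forallP => x; have [k] := ubnP (d x); elim: k x => // k IHk x.
rewrite ltnS => dk; have := FP x; rewrite /parent; have [-> _|xr [_ dx]] := eqVneq x r.
  exact: connect0.
apply: connect_trans (fconnect1 _ _) _; rewrite ffunE; apply: IHk.
exact: leq_trans dx dk.
Qed.

(** An edge of a tree outside a spanning tree would close a cycle with the path
that joins its ends in the spanning tree. *)
Lemma tree_edges E (r : 'I_m) : is_rooted_tree (E, r) ->
  exists2 f, rooted_at r f & edges f = E.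
Proof.
case/and3P => /= /forall_inP Es Ec /acyclic_graphP Ea.
have [f fT fE] := spanning_parent r Ec; exists f => //.
have sub x y : adj (edges f) x y -> adj E x y.
  rewrite adj_edges => /andP[xy /orP[]/eqP e].
    by rewrite -e; apply: fE; rewrite -(rooted_at_fix _ fT) e eq_sym.
  by rewrite adj_sym -e; apply: fE; rewrite -(rooted_at_fix _ fT) e.
apply/eqP; rewrite eqEsubset; apply/andP; split; apply/subsetP => e.
  case/imsetP => j; rewrite inE => fj ->; apply: fE.
  by rewrite -(rooted_at_fix _ fT).
move=> eE; have /cards2P[x [y [xy exy]]] := Es e eE.
rewrite exy in eE *; apply/negPn/negP => nxy.
have /forallP/(_ x)/forallP/(_ y)/connectP[p0 xp0 yp0] := edges_connected fT.
case/shortenP: xp0 yp0 => p xp up _ yp.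
case: p => [|a [|b p]] in xp up yp.
- by rewrite yp eqxx in xy.
- by case/negP: nxy; rewrite yp; case/andP: xp.
apply: (Ea [:: x, a, b & p]) => //; apply/andP; split=> //.
rewrite /cycle rcons_path (sub_path sub) // -yp.
by rewrite adj_sym.
Qed.

Lemma sum_rooted_trees (R : nmodType)
    (F : {set {set 'I_m}} * 'I_m -> R) :
  \sum_(T in rooted_trees m) F T
    = \sum_r \sum_(f | rooted_at r f) F (edges f, r).
Proof.
rewrite pair_big_dep /=.
pose D := [set rf : 'I_m * {ffun 'I_m -> 'I_m} | rooted_at rf.1 rf.2].
pose h (rf : 'I_m * {ffun 'I_m -> 'I_m}) := (edges rf.2, rf.1).
have -> : rooted_trees m = h @: D.
  apply/setP => -[E r]; rewrite inE; apply/idP/imsetP => [ET|[[r' f]]].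
    by have [f fT <-] := tree_edges ET; exists (r, f); rewrite ?inE.
  by rewrite inE => /= fT [-> ->]; apply: edges_tree.
rewrite big_imset => [|[r f] [r' g]]; first by apply: eq_bigl => rf; rewrite inE.
rewrite !inE => /= fT gT [efg err]; rewrite -err in gT *.
by rewrite (edges_inj fT gT efg).
Qed.

End TreesAsFunctions.

(** * Linear orders on a finite set *)

Section LinearOrders.

Variable m : nat.
Implicit Types (A : {set 'I_m}) (s : seq 'I_m).

Definition order_of_seq s : {set 'I_m * 'I_m} :=
  [set xy | [&& xy.1 \in s, xy.2 \in s & (index xy.1 s <= index xy.2 s)%N]].

Lemma mem_order_of_seq s x y :
  ((x, y) \in order_of_seq s) =
    [&& x \in s, y \in s & (index x s <= index y s)%N].
Proof. by rewrite inE. Qed.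

Lemma order_of_seq_trans s : transitive (fun x y => (x, y) \in order_of_seq s).
Proof.
move=> y x z; rewrite !mem_order_of_seq => /and3P[-> _ xy] /and3P[_ -> yz] /=.
exact: leq_trans xy yz.
Qed.

Lemma order_of_seq_anti s :
  antisymmetric (fun x y => (x, y) \in order_of_seq s).
Proof.
move=> x y; rewrite !mem_order_of_seq => /andP[/and3P[xs ys xy] /and3P[_ _ yx]].
  by apply: (index_inj x xs ys); apply/eqP; rewrite eqn_leq xy.
Qed.

Lemma order_of_seq_sorted s :
  uniq s -> sorted (fun x y => (x, y) \in order_of_seq s) s.
Proof.
move=> us; case def_s: s us => [//|x0 s']; rewrite -def_s => us.
apply/(sortedP x0) => i lti; have lti' := ltnW lti.
by rewrite mem_order_of_seq !mem_nth ?index_uniq /=.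
Qed.

Lemma order_of_seq_linear A s :
  perm_eq s (enum A) -> linear_order_on A (order_of_seq s).
Proof.
move=> sA; have memA x : (x \in A) = (x \in s).
  by rewrite (perm_mem sA) mem_enum.
apply/and5P; split.
- apply/subsetP => -[x y]; rewrite mem_order_of_seq in_setX /= !memA.
  by case/and3P => -> ->.
- by apply/forall_inP => x; rewrite mem_order_of_seq memA => ->; rewrite leqnn.
- apply/forallP => x; apply/forallP => y; apply/implyP => xy.
  exact/eqP/(order_of_seq_anti xy).
- apply/forallP => x; apply/forallP => y; apply/forallP => z.
  by apply/implyP => /andP[]; apply: order_of_seq_trans.
- apply/forall_inP => x xA; apply/forall_inP => y yA.
  by rewrite !mem_order_of_seq -!memA xA yA leq_total.
Qed.

Lemma linear_order_of_seq A X : linear_order_on A X ->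
  exists2 s, perm_eq s (enum A) & X = order_of_seq s.
Proof.
case/and5P => /subsetP XA /forall_inP Xr /forallP Xa /forallP Xt /forall_inP Xl.
pose leX x y := (x, y) \in X; exists (sort leX (enum A)).
  exact/permPl/perm_sort.
have memA x : (x \in sort leX (enum A)) = (x \in A).
  by rewrite mem_sort mem_enum.
have leX_tr : transitive leX.
  move=> y x z xy yz; have /forallP/(_ y)/forallP/(_ z)/implyP := Xt x.
  by apply; apply/andP.
have sX : sorted leX (sort leX (enum A)).
  apply: (@sort_sorted_in _ [in A]) => [x y xA yA|].
    by have /forall_inP := Xl x xA; apply.
  by apply/allP => x; rewrite mem_enum.
have leX_index : {in A &, forall x y,
    (index x (sort leX (enum A)) <= index y (sort leX (enum A)))%N -> leX x y}.
  move=> x y xA yA; apply: sorted_leq_index_in; rewrite ?memA //.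
    by move=> ? ? ? _ _ _; apply: leX_tr.
  by move=> z; rewrite memA; apply: Xr.
apply/setP => -[x y]; rewrite mem_order_of_seq !memA.
apply/idP/and3P => [xy|[xA yA]]; last exact: leX_index.
have := XA _ xy; rewrite in_setX /= => /andP[xA yA]; split=> //.
have [//|lt_yx] := leqP; have yx := leX_index y x yA xA (ltnW lt_yx).
have /forallP/(_ y)/implyP := Xa x; rewrite xy => /(_ yx)/eqP exy.
by rewrite exy ltnn in lt_yx.
Qed.

(** Linear orders on [A] correspond to the permutations of the sequence of its
elements: an order is read off from the indices, and sorting recovers the
sequence. *)
Lemma card_linear_orders A : #|[set X | linear_order_on A X]| = #|A|`!.
Proof.
rewrite [in RHS]cardE -(size_permutations (enum_uniq A)).
rewrite -(size_map order_of_seq); set L := map _ _.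
have uL : uniq L.
  rewrite map_inj_in_uniq ?permutations_uniq // => s s'.
  rewrite !mem_permutations => sA s'A ess'.
  apply: (sorted_eq (@order_of_seq_trans s) (@order_of_seq_anti s)).
  - by apply: order_of_seq_sorted; rewrite (perm_uniq sA) enum_uniq.
  - rewrite ess'.
    by apply: order_of_seq_sorted; rewrite (perm_uniq s'A) enum_uniq.
  - by rewrite (permPl sA) perm_sym.
rewrite -(card_uniqP uL); apply: eq_card => X; rewrite inE.
apply/idP/mapP => [/linear_order_of_seq[s sA ->]|[s sA ->]].
  by exists s; rewrite ?mem_permutations.
by apply: order_of_seq_linear; rewrite -mem_permutations.
Qed.

End LinearOrders.

(** * Generating functions of proper vertices *)

Lemma wdeg0 (R : comNzRingType) c : wdeg (0 : R) c = 1.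
Proof. by rewrite /wdeg big1 // => i _; rewrite mul0r addr0. Qed.

Lemma wdeg1 (R : comNzRingType) c : wdeg (1 : R) c = c`!%:R.
Proof.
elim: c => [|c IHc]; first by rewrite /wdeg big_ord0.
by rewrite wdegS IHc mul1r factS natrM mulrC -natr1 addrC.
Qed.

Lemma sum_rooted_trees_wdeg (R : comNzRingType) (t q : R) (n : nat) :
  \sum_(T in rooted_trees n.+1)
     (\prod_v wdeg q #|children T v|) * t ^+ pv T
  = t * \prod_(i < n) (((i + 1)%:R + q * i%:R) * t + (n - i)%:R).
Proof.
rewrite sum_rooted_trees -[in RHS](big_mkord xpredT (step_factor n.+1 t q)).
rewrite -[RHS](@rooted_sum n.+1) //; apply: eq_bigr => r _; apply: eq_bigr => f fT.
rewrite pv_edges //; congr (_ * _); apply: eq_bigr => v _.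
by rewrite children_edges.
Qed.

Lemma sum_plane_trees (R : comNzRingType) m (F : {set {set 'I_m}} * 'I_m -> R) :
  \sum_(P in plane_trees m) F P.1
    = \sum_(T in rooted_trees m) (\prod_v (#|children T v|`!)%:R) * F T.
Proof.
pose ord T (X : {ffun 'I_m -> {set 'I_m * 'I_m}}) :=
  [forall v, linear_order_on (children T v) (X v)].
transitivity (\sum_(T in rooted_trees m) \sum_(X | ord T X) F T).
  by rewrite pair_big_dep; apply: eq_bigl => -[T X]; rewrite !inE.
apply: eq_bigr => T _; rewrite sumr_const -[LHS]mulr_natl -natr_prod.
congr (_%:R * _); under [RHS]eq_bigr do rewrite -card_linear_orders.
pose orders v := [set X | linear_order_on (children T v) X].
transitivity #|family orders|; last first.
  by rewrite card_family foldrE big_map big_enum.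
apply: eq_card => X.
by apply/forallP/familyP => h v; have := h v; rewrite inE.
Qed.

Theorem mainTheorem5 (n : nat) :
  (\sum_(T in rooted_trees n.+1) 'X^(pv T) =
     'X * \prod_(i < n) ((i + 1)%:R * 'X + (n - i)%:R) :> {poly int})
  /\
  (\sum_(P in plane_trees n.+1) 'X^(pv P.1) =
     'X * \prod_(i < n) ((2 * i + 1)%:R * 'X + (n - i)%:R) :> {poly int}).
Proof.
split.
  transitivity (\sum_(T in rooted_trees n.+1)
      (\prod_v wdeg 0 #|children T v|) * 'X^(pv T) : {poly int}).
    apply: eq_bigr => T _; rewrite big1 ?mul1r // => v _; exact: wdeg0.
  rewrite sum_rooted_trees_wdeg; congr (_ * _); apply: eq_bigr => i _.
  by rewrite mul0r addr0.
rewrite (sum_plane_trees (fun T => 'X^(pv T))).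
transitivity (\sum_(T in rooted_trees n.+1)
    (\prod_v wdeg 1 #|children T v|) * 'X^(pv T) : {poly int}).
  apply: eq_bigr => T _; congr (_ * _); apply: eq_bigr => v _.
  by rewrite wdeg1.
rewrite sum_rooted_trees_wdeg; congr (_ * _); apply: eq_bigr => i _.
by rewrite mul1r -natrD addnAC addnn -mul2n.
Qed.
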